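(* Let $\mathcal R_{\mathbb K}[H]$ be the Hibi ring over a field $\mathbb K$ on a finite distributive lattice $H$, $P$ the poset of join-irreducible elements of $H$, and $\omega$ the canonical ideal of $\mathcal R_{\mathbb K}[H]$. For every positive integer $n$, $$\omega^n=\omega^{(n)}=\bigoplus_{\nu\in\mathcal T^{(n)}(P)}\mathbb K\,T^\nu,\qquad (\omega^{(-1)})^n=\omega^{(-n)}=\bigoplus_{\nu\in\mathcal T^{(-n)}(P)}\mathbb K\,T^\nu .$$
   Context: Let $x_0$ be the least element of $H$ and $P=\{\alpha\in H: \alpha=\beta\vee\gamma\Rightarrow\alpha=\beta\text{ or }\alpha=\gamma\}$ (so $x_0\in P$). With indeterminates $\{T_x\}_{x\in P}$, $\mathcal R_{\mathbb K}[H]=\mathbb K[\prod_{x\in I}T_x: I\text{ a nonempty down-closed subset of }P]$; it is a normal Cohen-Macaulay domain contained in $\mathbb K[T_x^{\pm1}\mid x\in P]$. Let $P^+=P\cup\{\infty\}$ with $x<\infty$ for all $x\in P$; $x\lessdot y$ means $y$ covers $x$. For $n\in\mathbb Z$, $\mathcal T^{(n)}(P)=\{\nu:P^+\to\mathbb Z\mid\nu(\infty)=0,\ \nu(x)-\nu(y)\ge n\text{ if }x\lessdot y\text{ in }P^+\}$, and $T^\nu=\prod_{x\in P}T_x^{\nu(x)}$. One has $\mathcal R_{\mathbb K}[H]=\bigoplus_{\nu\in\mathcal T^{(0)}(P)}\mathbb KT^\nu$, and the canonical ideal is $\omega=\bigoplus_{\nu\in\mathcal T^{(1)}(P)}\mathbb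 KT^\nu$ (isomorphic to the canonical module). For a Noetherian normal domain $R$ with fraction field $Q(R)$, a fractional ideal $I$ is divisorial if $R:_{Q(R)}(R:_{Q(R)}I)=I$. Divisorial ideals form a group $\mathrm{Div}(R)$ under $I\cdot J=R:_{Q(R)}(R:_{Q(R)}IJ)$, and $I^{(n)}$ ($n\in\mathbb Z$) is the $n$-th power of $I$ in this group; the inverse of $I$ is $R:_{Q(R)}I$. $I^n$ without parentheses is the ordinary power of fractional ideals. *)

(* Defs.v *)
From HB Require Import structures.
From mathcomp Require Import all_boot all_order all_algebra.
From mathcomp Require Import boolp classical_sets.
From mathcomp Require Import mpoly.

Set Implicit Arguments.
Unset Strict Implicit.
Unset Printing Implicit Defensive.

Import Order.TTheory GRing.Theory.

Local Open Scope ring_scope.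
Local Open Scope classical_set_scope.

(* Fractional ideals.  A domain R is a subset of an ambient field F, closed   *)
(* under the ring operations; its fraction field is the subfield frac R of F. *)

Definition frac (F : fieldType) (R : set F) : set F :=
  [set q | exists a b : F, [/\ R a, R b, b != 0 & q = a / b]].

(* R :_{Q(R)} I *)
Definition colon (F : fieldType) (R I : set F) : set F :=
  [set q | frac R q /\ forall a, I a -> R (q * a)].

(* I J, the set of finite sums of products *)
Definition idmul (F : fieldType) (I J : set F) : set F :=
  [set q | exists s : seq (F * F),
     (forall p, p \in s -> I p.1 /\ J p.2) /\ q = \sum_(p <- s) p.1 * p.2].

(* I^n, for n : nat *)
Definition idexp (F : fieldType) (R I : set F) (n : nat) : set F :=
  iter n (idmul I) R.

(* For a Noetherian R, the existence of a common denominator is the same as   *)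
(* finite generation.                                                         *)
Definition fractional_ideal (F : fieldType) (R I : set F) : Prop :=
  [/\ I `<=` frac R,
      forall r a b, R r -> I a -> I b -> I (r * a + b),
      exists2 a, I a & a != 0
    & exists2 d, R d /\ d != 0 & forall a, I a -> R (d * a)].

(* Div(R) *)
Definition Div (F : fieldType) (R : set F) : set (set F) :=
  [set I | fractional_ideal R I /\ colon R (colon R I) = I].

Definition divmul (F : fieldType) (R I J : set F) : set F :=
  colon R (colon R (idmul I J)).

Definition divinv (F : fieldType) (R I : set F) : set F := colon R I.

(* I^(n), for n : int and I in Div(R): the group Div(R) has product divmul R, *)
(* identity R and inverse divinv R.                                           *)
Definition divexp (F : fieldType) (R I : set F) (n : int) : set F :=
  match n with
  | Posz m => iter m (divmul R I) R
  | Negz m => iter m.+1 (divmul R (divinv R I)) R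
  end.

(* The poset P.  With this definition of join-irreducibility, the bottom      *)
(* element of H belongs to P.                                                 *)

Definition joinirr d (H : finTBDistrLatticeType d) (a : H) : bool :=
  [forall b : H, forall c : H,
     (a == Order.join b c) ==> (a == b) || (a == c)].

Notation jirr H := {a : H | joinirr a}.

(* P^+ is option P, with None in the role of infinity. *)
Definition lt_plus d (H : finTBDistrLatticeType d) (x y : option (jirr H)) :
    bool :=
  match x, y with
  | Some a, Some b => (val a < val b)%O
  | Some _, None => true
  | None, _ => false
  end.

(* y covers x in P^+ *)
Definition covered d (H : finTBDistrLatticeType d) (x y : option (jirr H)) :
    bool :=
  lt_plus x y && ~~ [exists z, lt_plus x z && lt_plus z y].

Definition Tset d (H : finTBDistrLatticeType d) (n : int) :
    set {ffun option (jirr H) -> int} :=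
  [set nu | nu None = 0 /\
     forall x y, covered x y -> n <= nu x - nu y].

Arguments Tset {d} H n.

(* The ambient field K(T_x | x in P), which contains the Laurent polynomial   *)
(* ring K[T_x^{+-1} | x in P].                                                *)

Definition ratfun (K : fieldType) d (H : finTBDistrLatticeType d) :
    fieldType :=
  {fraction {mpoly K[#|{: jirr H}|]}}.

Arguments ratfun K {d} H.

Definition cst (K : fieldType) d (H : finTBDistrLatticeType d) (c : K) :
    ratfun K H :=
  tofrac c%:MP.

Arguments cst {K d} H c.

Definition Tvar (K : fieldType) d (H : finTBDistrLatticeType d) (x : jirr H) :
    ratfun K H :=
  tofrac 'X_(enum_rank x).

Arguments Tvar K {d H} x.

Definition Tmon (K : fieldType) d (H : finTBDistrLatticeType d)
    (nu : {ffun option (jirr H) -> int}) : ratfun K H :=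
  \prod_(x : jirr H) Tvar K x ^ nu (Some x).

Arguments Tmon K {d H} nu.

(* the sum of the K T^nu, for nu in A *)
Definition Tspan (K : fieldType) d (H : finTBDistrLatticeType d)
    (A : set {ffun option (jirr H) -> int}) : set (ratfun K H) :=
  [set f | exists (s : seq {ffun option (jirr H) -> int})
                  (c : {ffun option (jirr H) -> int} -> K),
     (forall nu, nu \in s -> A nu) /\
     f = \sum_(nu <- s) cst H (c nu) * Tmon K nu].

Arguments Tspan K {d} H A.

(* W is the internal direct sum of the K T^nu, for nu in A, each of           *)
(* dimension one.                                                             *)
Definition is_Tdirect_sum (K : fieldType) d (H : finTBDistrLatticeType d)
    (W : set (ratfun K H)) (A : set {ffun option (jirr H) -> int}) : Prop :=
  W = Tspan K H A /\
  forall (s : seq {ffun option (jirr H) -> int})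
         (c : {ffun option (jirr H) -> int} -> K),
    uniq s -> (forall nu, nu \in s -> A nu) ->
    \sum_(nu <- s) cst H (c nu) * Tmon K nu = 0 ->
    forall nu, nu \in s -> c nu = 0.

(* The Hibi ring: the K-subalgebra generated by the products over the         *)
(* nonempty down-closed subsets of P.                                         *)

Definition down_closed d (H : finTBDistrLatticeType d) (I : {set jirr H}) :
    Prop :=
  forall x y : jirr H, (val x <= val y)%O -> y \in I -> x \in I.

Definition hibi_gens (K : fieldType) d (H : finTBDistrLatticeType d) :
    set (ratfun K H) :=
  [set f | exists I : {set jirr H},
     [/\ I != finset.set0, down_closed I & f = \prod_(x in I) Tvar K x]].

Arguments hibi_gens K {d} H.

Definition subalgebra (K : fieldType) d (H : finTBDistrLatticeType d)
    (S : set (ratfun K H)) : Prop :=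
  [/\ forall c : K, S (cst H c),
      forall f g, S f -> S g -> S (f - g)
    & forall f g, S f -> S g -> S (f * g)].

Definition hibi (K : fieldType) d (H : finTBDistrLatticeType d) :
    set (ratfun K H) :=
  smallest (@subalgebra K d H) (hibi_gens K H).

Arguments hibi K {d} H.

Definition omega (K : fieldType) d (H : finTBDistrLatticeType d) :
    set (ratfun K H) :=
  Tspan K H (Tset H 1).

Arguments omega K {d} H.

(* Main.v *)
Require Import Defs.
From HB Require Import structures.
From mathcomp Require Import all_boot all_order all_algebra.
From mathcomp Require Import boolp classical_sets.
From mathcomp Require Import zify.
From mathcomp Require Import mpoly.

Set Implicit Arguments.
Unset Strict Implicit.
Unset Printing Implicit Defensive.

Import Order.TTheory GRing.Theory Num.Theory.

Local Open Scope ring_scope.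
Local Open Scope classical_set_scope.

(** Every module in the theorem is spanned over K by Laurent monomials, so the
    statement comes down to facts about the exponent sets T^(k), k an integer.
    Write M(k) for the K-span of the T^nu with nu in T^(k).

    The Hibi ring is M(0) ([hibiE]): a nonnegative order-reversing nu is the
    sum of the indicators of its level sets {nu >= i}, which are down-closed.

    Products are governed by Euclidean division ([Tset_split]).  For nu in
    T^(k(n+1)), the function floor(nu / (n+1)) lies in T^(k) and the difference
    nu - floor(nu / (n+1)) lies in T^(kn), because both u |-> floor(u / (n+1))
    and u |-> u - floor(u / (n+1)) are monotone and increase by exactly 1 and n
    when u increases by n+1.  Hence M(k) M(kn) = M(k(n+1)), whatever the sign
    of k, and the ordinary n-th power of M(k) is M(kn) ([idexp_T]).

    Colon ideals are governed by tight exponents ([Tset_tight]): for every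
    covering relation x < y and every k there is some nu in T^(k) with
    nu(x) - nu(y) = k.  If q M(k) is contained in M(0), then q is a Laurent
    polynomial, and every exponent mu of q satisfies mu + nu in T^(0) for all
    nu in T^(k), the monomials being linearly independent ([Tmon_free]); taking
    nu tight at x < y gives mu(x) - mu(y) >= -k.  So M(0) : M(k) = M(-k)
    ([colon_T]).  In particular every M(k) is divisorial, so divisorial powers
    of M(k) coincide with the ordinary ones, and the theorem is the case
    k = 1 together with the case k = -1. *)

(** * Exponents *)

Section Exponents.

Variables (d : Order.disp_t) (H : finTBDistrLatticeType d).
Local Notation V := {ffun option (jirr H) -> int}.

Implicit Types (x y z : option (jirr H)) (nu mu : V) (k m : int).

(** Evaluation of sums and opposites at a point, in a form whose atoms are
    syntactically the [nu x] that occur in [Tset], as arithmetic decision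
    procedures require. *)
Lemma expoD nu mu x : (nu + mu) x = nu x + mu x.
Proof. by rewrite ffunE. Qed.

Lemma expoN nu x : (- nu) x = - nu x.
Proof. by rewrite ffunE. Qed.

Lemma lt_plus_irr x : lt_plus x x = false.
Proof. by case: x => //= a; rewrite ltxx. Qed.

Lemma lt_plus_trans : transitive (@lt_plus d H).
Proof. by move=> [b|] [a|] [c|] //=; exact: lt_trans. Qed.

(** In a finite poset, any strict inequality is a chain of coverings; the
    induction is on the number of elements strictly between the endpoints. *)
Lemma lt_plus_cover_ind (R : option (jirr H) -> option (jirr H) -> Prop) :
    (forall x y, covered x y -> R x y) ->
    (forall x y z, R x y -> R y z -> R x z) ->
  forall x y, lt_plus x y -> R x y.
Proof.
move=> Rcov Rtr x y.
have [n] := ubnP #|[set z | lt_plus x z && lt_plus z y]%SET|.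
elim: n x y => // n IHn x y; rewrite ltnS => lt_n xy.
have [/existsP[z /andP[xz zy]]|nz] :=
  boolP [exists z, lt_plus x z && lt_plus z y]; last first.
  by apply: Rcov; rewrite /covered xy.
have zxy : z \in [set z | lt_plus x z && lt_plus z y]%SET by rewrite inE xz.
apply: (Rtr _ z); apply: IHn => //; apply: leq_trans lt_n;
  apply/proper_card/properP; split.
- by apply/fintype.subsetP => w; rewrite !inE => /andP[-> /lt_plus_trans->].
- by exists z; rewrite // inE lt_plus_irr andbF.
- apply/fintype.subsetP => w; rewrite !inE => /andP[].
  by move=> /(lt_plus_trans xz)-> ->.
- by exists z; rewrite // inE lt_plus_irr.
Qed.

Lemma Tset0_antitone nu x y : Tset H 0 nu -> lt_plus x y -> nu y <= nu x.
Proof.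
move=> [_ nuP]; move: x y; apply: lt_plus_cover_ind => [x y /nuP|x y z].
  by rewrite subr_ge0.
by move=> le_yx /le_trans; apply.
Qed.

Lemma Tset0_ge0 nu x : Tset H 0 nu -> 0 <= nu x.
Proof.
case: x => [a|] nuT; last by rewrite nuT.1.
by rewrite -nuT.1; apply: Tset0_antitone.
Qed.

Lemma Tset0P nu :
    nu None = 0 -> (forall x y, lt_plus x y -> nu y <= nu x) -> Tset H 0 nu.
Proof. by move=> nu0 nuP; split=> // x y /andP[/nuP]; rewrite subr_ge0. Qed.

Lemma TsetD k m nu mu : Tset H k nu -> Tset H m mu -> Tset H (k + m) (nu + mu).
Proof.
move=> [nu0 nuP] [mu0 muP]; split=> [|x y xy]; rewrite !expoD ?nu0 ?mu0 //.
by have := nuP _ _ xy; have := muP _ _ xy; lia.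
Qed.

(** Both u |-> floor(u / (n+1)) and u |-> u - floor(u / (n+1)) are monotone, and
    they are shifted by k and kn when u is shifted by k(n+1): the two parts
    inherit their inequalities from that of nu.  As k may be
    negative, this covers the powers of omega and of its inverse alike. *)
Lemma Tset_split k (n : nat) nu : Tset H (k * n.+1%:Z) nu ->
  exists a b, [/\ Tset H k a, Tset H (k * n%:Z) b & nu = a + b].
Proof.
move=> [nu0 nuP]; pose a : V := [ffun x => (nu x %/ n.+1%:Z)%Z].
(* Monotonicity and shift of the quotient and of its complement, in one go. *)
have step u v : k * n.+1%:Z <= u - v ->
  k <= (u %/ n.+1%:Z)%Z - (v %/ n.+1%:Z)%Z /\
  k * n%:Z <= (u - (u %/ n.+1%:Z)%Z) - (v - (v %/ n.+1%:Z)%Z).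
  have := modz_ge0 u (isT : n.+1%:Z != 0).
  have := ltz_pmod u (isT : 0 < n.+1%:Z).
  have := modz_ge0 v (isT : n.+1%:Z != 0).
  have := ltz_pmod v (isT : 0 < n.+1%:Z).
  have := divz_eq u n.+1%:Z; have := divz_eq v n.+1%:Z.
  move: (u %/ _)%Z (u %% _)%Z (v %/ _)%Z (v %% _)%Z => q r q' r' -> -> *.
  by split; nia.
have aE x : a x = (nu x %/ n.+1%:Z)%Z by rewrite ffunE.
exists a, (nu - a); split; last by rewrite addrC subrK.
- by split=> [|x y /nuP]; rewrite !aE ?nu0 // => /step[].
- by split=> [|x y /nuP]; rewrite !expoD !expoN !aE ?nu0 // => /step[].
Qed.

(** The principal up-set of z after x and y have been identified: as the
    identification of a covering pair is again a poset, the cardinal of this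
    set is strictly decreasing in z, except that x and y have the same one. *)
Definition merge_up x y z :=
  [set w | (w == z) || lt_plus z w
           || ((z == y) || lt_plus z y) && ((w == x) || lt_plus x w)]%SET.

(** The only way to lose strictness would be v <= y and x <= u with u < v, that
    is x <= u < v <= y, which forces (u, v) = (x, y) since y covers x. *)
Lemma merge_up_lt x y u v : covered x y -> lt_plus u v -> (u, v) != (x, y) ->
  (#|merge_up x y v| < #|merge_up x y u|)%N.
Proof.
move=> /andP[xy /existsPn cov] uv /eqP ne; apply/proper_card/properP.
have tr := lt_plus_trans; split.
  apply/fintype.subsetP => w; rewrite !inE.
  move=> /orP[/orP[/eqP->|/(tr _ _ _ uv)->]|].
  - by rewrite uv orbT.
  - by rewrite orbT.
  - case/andP=> vy ->; rewrite andbT; apply/orP; right; apply/orP; right.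
    by case/predU1P: vy => [<-|/(tr _ _ _ uv)].
exists u; rewrite !inE ?eqxx //; apply/negP.
move=> /orP[/predU1P[|]|/andP[/predU1P[]]].
- by move=> eq_uv; rewrite eq_uv lt_plus_irr in uv.
- by move/(tr _ _ _ uv); rewrite lt_plus_irr.
- move=> vy /predU1P[ux|xu]; first by apply: ne; rewrite ux vy.
  by have := cov u; rewrite xu -vy uv.
- move=> vy /predU1P[ux|xu]; first by have := cov v; rewrite -ux uv vy.
  by have := cov u; rewrite xu (tr _ _ _ uv vy).
Qed.

Lemma merge_up_eq x y : lt_plus x y -> merge_up x y x = merge_up x y y.
Proof.
move=> xy; apply/setP=> w; rewrite !inE xy eqxx orbT /=.
rewrite orbb; apply/idP/idP => [->|]; first by rewrite orbT.
by case/orP=> // /predU1P[->|/(lt_plus_trans xy)->]; rewrite ?xy orbT.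
Qed.

(** A function that decreases strictly along every covering except that of x by
    y, where it is constant, leaves the gap at (x, y) free: the gap can be set
    to k at x alone, and a large multiple of that function restores the other
    inequalities.  Tight exponents are what makes the colon ideals no larger
    than expected. *)
Lemma Tset_tight k x y : covered x y ->
  exists2 nu, Tset H k nu & nu x - nu y = k.
Proof.
move=> xy; have lt_xy : lt_plus x y by case/andP: xy.
pose h z : int := #|merge_up x y z|.
(* The term supported at x creates the gap k between x and y, and spoils the
   other coverings by at most |k|; the cardinal, normalised to vanish at
   infinity, does not change the gap, and 2|k| times it repairs the others. *)
pose nu : V := [ffun z => k * (z == x) + (`|k| * 2)%:Z * (h z - h None)].
have nuE z : nu z = k * (z == x) + (`|k| * 2)%:Z * (h z - h None).
  by rewrite ffunE.
have xN : (None == x) = false by case: (x) lt_xy.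
have yx : (y == x) = false by apply/eqP => yx; rewrite yx lt_plus_irr in lt_xy.
have tight : nu x - nu y = k.
  by rewrite !nuE eqxx yx /h merge_up_eq //; lia.
exists nu => //; split=> [|u v uv]; first by rewrite nuE xN; lia.
have [[-> ->]|ne] := eqVneq (u, v) (x, y); first by rewrite tight.
have lt_uv : lt_plus u v by case/andP: uv.
have lt_h : h v + 1 <= h u.
  by have := merge_up_lt xy lt_uv ne; rewrite /h; lia.
rewrite !nuE; have [t ->] : exists t : nat, h u = h v + 1 + t%:Z.
  by exists `|(h u - h v - 1)%R|%N; lia.
case: (u == x); case: (v == x); nia.
Qed.

Lemma Tset_nonempty k : exists nu, Tset H k nu.
Proof.
have [/existsP[x /existsP[y /(Tset_tight k)[nu]]]|/existsPn nocov] :=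
  boolP [exists x : option (jirr H), exists y, covered x y].
  by exists nu.
exists 0; split=> [|x y xy]; first by rewrite ffunE.
by have /existsPn/(_ y) := nocov x; rewrite xy.
Qed.

Lemma Tset_sub0 k nu : 0 <= k -> Tset H k nu -> Tset H 0 nu.
Proof. by move=> k0 [nu0 nuP]; split=> // x y /nuP; exact: le_trans. Qed.

Lemma Tset_denominator k : exists2 la, Tset H 0 la &
  forall nu, Tset H k nu -> Tset H 0 (la + nu).
Proof.
have [la laT] := Tset_nonempty `|k|; exists la.
  by apply: Tset_sub0 laT.
by move=> nu /(TsetD laT); apply: Tset_sub0; lia.
Qed.

End Exponents.

(** * Spans of Laurent monomials *)

Section Laurent.

Variables (K : fieldType) (d : Order.disp_t) (H : finTBDistrLatticeType d).
Local Notation V := {ffun option (jirr H) -> int}.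
Local Notation F := (ratfun K H).

Implicit Types (nu mu : V) (c e : V -> K) (f g : F) (A B C : set V).

Lemma cst_is_additive : zmod_morphism (@cst K d H).
Proof. by move=> a b; rewrite /cst mpolyCB tofracB. Qed.

HB.instance Definition _ :=
  GRing.isZmodMorphism.Build K F (@cst K d H) cst_is_additive.

Lemma cstM : {morph @cst K d H : a b / a * b}.
Proof. by move=> a b; rewrite /cst mpolyCM tofracM. Qed.

Lemma cst1 : cst H 1 = 1 :> F.
Proof. by rewrite /cst mpolyC1 tofrac1. Qed.

Lemma mpolyX_neq0 n (m : 'X_{1.. n}) : 'X_[m] != 0 :> {mpoly K[n]}.
Proof.
apply/eqP => /(congr1 (mcoeff m)) /eqP.
by rewrite mcoeffX mcoeff0 eqxx oner_eq0.
Qed.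

Lemma Tvar_neq0 (x : jirr H) : Tvar K x != 0.
Proof. by rewrite /Tvar tofrac_eq0 mpolyX_neq0. Qed.

Lemma Tmon_neq0 nu : Tmon K nu != 0.
Proof. by apply/prodf_neq0 => x _; rewrite expfz_neq0 ?Tvar_neq0. Qed.

Lemma Tmon0 : Tmon K (0 : V) = 1.
Proof. by rewrite /Tmon big1 // => x _; rewrite ffunE expr0z. Qed.

Lemma TmonD nu mu : Tmon K (nu + mu) = Tmon K nu * Tmon K mu.
Proof.
by rewrite -big_split; apply: eq_bigr => x _; rewrite expoD expfzDr ?Tvar_neq0.
Qed.

Lemma TmonK nu mu : Tmon K (nu - mu) * Tmon K mu = Tmon K nu.
Proof. by rewrite -TmonD subrK. Qed.

Definition mnm_of nu : 'X_{1.. #|{: jirr H}|} :=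
  [multinom `|nu (Some (enum_val i))|%N | i < #|{: jirr H}|].

Lemma Tmon_mpoly nu : (forall x, 0 <= nu x) ->
  Tmon K nu = tofrac 'X_[mnm_of nu].
Proof.
move=> nu0; rewrite mpolyXE_id rmorph_prod /Tmon.
rewrite (reindex_onto (@enum_rank {: jirr H}) (@enum_val {: jirr H} _)) /=;
  last by move=> i _; exact: enum_valK.
apply: eq_big => [x|x _]; first by rewrite enum_rankK eqxx.
by rewrite rmorphXn mnmE enum_rankK exprnP gez0_abs.
Qed.

Lemma mnm_of_inj nu mu : (forall x, 0 <= nu x) -> (forall x, 0 <= mu x) ->
  nu None = mu None -> mnm_of nu = mnm_of mu -> nu = mu.
Proof.
move=> nu0 mu0 eqN /mnmP eqm; apply/ffunP => -[a|//].
have := eqm (enum_rank a); rewrite !mnmE enum_rankK => eq_a.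
rewrite -(gez0_abs (nu0 (Some a))) -(gez0_abs (mu0 (Some a))).
by rewrite eq_a.
Qed.

(** After multiplication by a monomial that clears the denominators, distinct
    exponents become distinct monomials of the polynomial ring.  Exponents must
    agree at infinity, a value that [Tmon] does not see. *)
Lemma Tmon_free (s : seq V) c : uniq s ->
    (forall nu, nu \in s -> nu None = 0) ->
    \sum_(nu <- s) cst H (c nu) * Tmon K nu = 0 ->
  forall nu, nu \in s -> c nu = 0.
Proof.
move=> s_uniq sN sum0 nu0 nu0s.
pose la : V := [ffun x => \sum_(nu <- s) `|nu x|].
have shift0 nu x : nu \in s -> 0 <= (nu + la) x.
  move=> nus; rewrite expoD [la x]ffunE (big_rem nu) //=.
  have := sumr_ge0 (rem nu s) (fun i : V => fun=> normr_ge0 (i x)) (P := predT).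
  by move: (\sum_(_ <- _) _) => t; lia.
have : tofrac (\sum_(nu <- s) c nu *: 'X_[mnm_of (nu + la)]) = 0 :> F.
  rewrite rmorph_sum -[RHS](mul0r (Tmon K la)) -[in RHS]sum0 mulr_suml.
  apply: eq_big_seq => nu nus; rewrite /= -mul_mpolyC rmorphM -mulrA -TmonD.
  by rewrite [in RHS]Tmon_mpoly // => x; apply: shift0.
move/eqP; rewrite tofrac_eq0 => /eqP/(congr1 (mcoeff (mnm_of (nu0 + la)))).
rewrite mcoeff0 raddf_sum /= (bigD1_seq nu0) //= mcoeffZ mcoeffX eqxx mulr1.
rewrite big_seq_cond big1 ?addr0 // => nu /andP[nus ne].
rewrite mcoeffZ mcoeffX; case: eqP => [eqm|_]; last by rewrite mulr0.
case/eqP: ne; apply: (addIr la); apply: mnm_of_inj eqm => [x|x|].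
- exact: shift0.
- exact: shift0.
- by rewrite !expoD (sN _ nus) (sN _ nu0s).
Qed.

(** [c] is the coefficient function of the Laurent polynomial [f]. *)
Definition expands f c := exists s : seq V,
  [/\ uniq s, forall nu, c nu != 0 -> nu \in s
    & f = \sum_(nu <- s) cst H (c nu) * Tmon K nu].

Lemma expands_on f c (s : seq V) : expands f c ->
    uniq s -> (forall nu, c nu != 0 -> nu \in s) ->
  f = \sum_(nu <- s) cst H (c nu) * Tmon K nu.
Proof.
have restrict (t : seq V) : \sum_(nu <- t) cst H (c nu) * Tmon K nu
    = \sum_(nu <- [seq nu <- t | c nu != 0]) cst H (c nu) * Tmon K nu.
  rewrite big_filter [LHS](bigID (fun nu => c nu != 0)) /= addrC big1 ?add0r //.
  by move=> nu /negbNE/eqP->; rewrite raddf0 mul0r.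
move=> [t [t_uniq tP ->]] s_uniq sP; rewrite restrict [RHS]restrict.
apply: perm_big; apply: uniq_perm; rewrite ?filter_uniq // => nu.
by rewrite !mem_filter; case: eqP => //= /eqP c0; rewrite tP ?sP.
Qed.

Lemma expands_common f g c e : expands f c -> expands g e ->
  exists s : seq V, [/\ uniq s, forall nu, c nu != 0 -> nu \in s &
    forall nu, e nu != 0 -> nu \in s].
Proof.
move=> [s [_ sP _]] [t [_ tP _]]; exists (undup (s ++ t)).
split=> [|nu /sP|nu /tP]; rewrite ?undup_uniq // mem_undup mem_cat => -> //.
by rewrite orbT.
Qed.

Lemma expands_inj f c e : expands f c -> expands f e ->
    (forall nu, c nu != 0 -> nu None = 0) ->
    (forall nu, e nu != 0 -> nu None = 0) -> c =1 e.
Proof.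
move=> fc fe cN eN; have [s [s_uniq sc se]] := expands_common fc fe.
pose s' := [seq nu <- s | (nu : V) None == 0].
have s'_uniq : uniq s' by rewrite filter_uniq.
have s'c nu : c nu != 0 -> nu \in s'.
  by move=> c0; rewrite mem_filter sc // cN // eqxx.
have s'e nu : e nu != 0 -> nu \in s'.
  by move=> e0; rewrite mem_filter se // eN // eqxx.
have eq0 nu : nu \in s' -> c nu - e nu = 0.
  apply: (@Tmon_free s' (fun nu => c nu - e nu)) => //.
    by move=> mu; rewrite mem_filter => /andP[/eqP].
  have := expands_on fc s'_uniq s'c; rewrite {1}(expands_on fe s'_uniq s'e).
  move=> /esym/eqP; rewrite -subr_eq0 -sumrB => /eqP sum0; rewrite -{}[RHS]sum0.
  by apply: eq_bigr => mu _; rewrite raddfB /= mulrBl.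
move=> nu; have [/eq0/eqP|nus] := boolP (nu \in s').
  by rewrite subr_eq0 => /eqP.
by rewrite (contraNeq (@s'c nu)) // (contraNeq (@s'e nu)).
Qed.

Lemma expandsD f g c e : expands f c -> expands g e ->
  expands (f + g) (fun nu => c nu + e nu).
Proof.
move=> fc ge; have [s [s_uniq sc se]] := expands_common fc ge.
exists s; split=> // [nu|].
  by apply: contraR => nus; rewrite (contraNeq (@sc nu)) //;
    rewrite (contraNeq (@se nu)) // addr0.
rewrite (expands_on fc s_uniq sc) (expands_on ge s_uniq se) -big_split.
by apply: eq_bigr => nu _; rewrite raddfD /= mulrDl.
Qed.

Lemma expands_mon (a : K) nu :
  expands (cst H a * Tmon K nu) (fun mu => a *+ (mu == nu)).
Proof.
exists [:: nu]; split=> // [mu|]; last by rewrite big_seq1 eqxx.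
by rewrite inE; case: (mu == nu) => //; rewrite eqxx.
Qed.

Lemma expands_shift f c mu : expands f c ->
  expands (f * Tmon K mu) (fun nu => c (nu - mu)).
Proof.
move=> [s [s_uniq sc ->]]; exists [seq nu + mu | nu <- s]; split.
- by rewrite map_inj_uniq //; exact: addIr.
- by move=> nu /sc nus; apply/mapP; exists (nu - mu); rewrite ?subrK.
rewrite big_map mulr_suml; apply: eq_bigr => nu _.
by rewrite addrK TmonD mulrA.
Qed.

(** The list in [Tspan] may have repetitions and zero coefficients; this form
    gives access to the support, which [expands_inj] makes unique. *)
Lemma TspanP A f :
  Tspan K H A f <-> exists2 c, expands f c & forall nu, c nu != 0 -> A nu.
Proof.
split=> [[s [c [sA ->]]]|[c [s [s_uniq sc ->]] cA]]; last first.
  exists [seq nu <- s | c nu != 0], c; split=> [nu|].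
    by rewrite mem_filter => /andP[/cA].
  apply: expands_on; first by exists s.
    exact: filter_uniq.
  by move=> nu c0; rewrite mem_filter c0 sc.
elim: s sA => [|nu s IHs] sA.
  exists (fun=> 0) => [|nu]; rewrite ?eqxx //.
  by exists [::]; split=> // [nu|]; rewrite ?eqxx ?big_nil.
rewrite big_cons; have [|e fe eA] := IHs.
  by move=> mu mus; apply: sA; rewrite inE mus orbT.
exists (fun mu => c nu *+ (mu == nu) + e mu).
  exact: expandsD (expands_mon _ _) fe.
move=> mu; have [->|_] := eqVneq mu nu; last first.
  by rewrite add0r => /eA.
by move=> _; apply: sA; rewrite inE eqxx.
Qed.

Lemma Tspan_mon A (a : K) nu : A nu -> Tspan K H A (cst H a * Tmon K nu).
Proof.
move=> Anu; exists [:: nu], (fun=> a); rewrite big_seq1.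
by split=> // mu; rewrite inE => /eqP->.
Qed.

Lemma Tspan_Tmon A nu : A nu -> Tspan K H A (Tmon K nu).
Proof. by rewrite -[Tmon K nu]mul1r -cst1; exact: Tspan_mon. Qed.

Lemma Tspan0 A : Tspan K H A 0.
Proof. by exists [::], (fun=> 0); rewrite big_nil. Qed.

Lemma TspanD A f g : Tspan K H A f -> Tspan K H A g -> Tspan K H A (f + g).
Proof.
move=> /TspanP[c fc cA] /TspanP[e ge eA]; apply/TspanP.
exists (fun nu => c nu + e nu); first exact: expandsD.
move=> nu; have [c0|/cA//] := eqVneq (c nu) 0.
by rewrite c0 add0r => /eA.
Qed.

Lemma Tspan_ind A (Q : F -> Prop) : Q 0 ->
    (forall f g, Q f -> Q g -> Q (f + g)) ->
    (forall a nu, A nu -> Q (cst H a * Tmon K nu)) ->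
  forall f, Tspan K H A f -> Q f.
Proof.
move=> Q0 QD Qmon _ [s [c [sA ->]]]; elim: s sA => [|nu s IHs] sA.
  by rewrite big_nil.
rewrite big_cons; apply: QD.
  by apply: Qmon; apply: sA; rewrite inE eqxx.
by apply: IHs => mu mus; apply: sA; rewrite inE mus orbT.
Qed.

Lemma TspanM A B C f g : (forall nu mu, A nu -> B mu -> C (nu + mu)) ->
  Tspan K H A f -> Tspan K H B g -> Tspan K H C (f * g).
Proof.
move=> ABC fA; move: g; apply: Tspan_ind => [|g g'|b mu Bmu].
- by rewrite mulr0; exact: Tspan0.
- by rewrite mulrDr; exact: TspanD.
move: f fA; apply: Tspan_ind => [|f f'|a nu Anu].
- by rewrite mul0r; exact: Tspan0.
- by rewrite mulrDl; exact: TspanD.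
by rewrite mulrACA -cstM -TmonD; apply: Tspan_mon; exact: ABC.
Qed.

Lemma Tspan_direct A : (forall nu, A nu -> nu None = 0) ->
  is_Tdirect_sum (Tspan K H A) A.
Proof.
move=> AN; split=> // s c s_uniq sA; apply: Tmon_free => // nu /sA; exact: AN.
Qed.

Lemma idmul_Tspan A B C : (forall nu mu, A nu -> B mu -> C (nu + mu)) ->
    (forall la, C la -> exists nu mu, [/\ A nu, B mu & la = nu + mu]) ->
  idmul (Tspan K H A) (Tspan K H B) = Tspan K H C.
Proof.
move=> ABC CAB; apply/seteqP; split=> [_ [s [sP ->]]|].
  elim: s sP => [|p s IHs] sP; first by rewrite big_nil; exact: Tspan0.
  rewrite big_cons; apply: TspanD.
    by have [] := sP p (mem_head _ _); exact: TspanM.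
  by apply: IHs => q qs; apply: sP; rewrite inE qs orbT.
move=> f; apply: Tspan_ind => {f} [|_ _ [s [sP ->]] [t [tP ->]]|a la].
- by exists [::]; rewrite big_nil.
- exists (s ++ t); rewrite big_cat; split=> // p.
  by rewrite mem_cat => /orP[/sP|/tP].
move=> /CAB[nu [mu [Anu Bmu ->]]].
exists [:: (cst H a * Tmon K nu, Tmon K mu)]; rewrite big_seq1 TmonD mulrA.
split=> // p; rewrite inE => /eqP->; split=> /=.
  exact: Tspan_mon.
exact: Tspan_Tmon.
Qed.

End Laurent.

(** * The Hibi ring and its divisorial ideals *)

Section Hibi.

Variables (K : fieldType) (d : Order.disp_t) (H : finTBDistrLatticeType d).
Local Notation V := {ffun option (jirr H) -> int}.
Local Notation F := (ratfun K H).
Local Notation T k := (Tspan K H (Tset H k)).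

Implicit Types (nu mu : V) (f g : F) (I : {set jirr H}) (k m : int).

Definition indic I : V :=
  [ffun x => if x is Some a then (a \in I)%:Z else 0].

Lemma Tmon_indic I : Tmon K (indic I) = \prod_(a in I) Tvar K a.
Proof.
rewrite [RHS]big_mkcond; apply: eq_bigr => a _; rewrite ffunE.
by case: (a \in I).
Qed.

Lemma Tset_indic I : down_closed I -> Tset H 0 (indic I).
Proof.
move=> Idown; apply: Tset0P => [|[a|] [b|]]; rewrite !ffunE // => ab.
have := Idown a b (ltW ab); case: (b \in I); last by case: (a \in I).
by move=> ->.
Qed.

(** For nu nonzero, the set {nu > 0} is down-closed, and dividing T^nu by the
    corresponding generator lowers the maximum of nu by one. *)
Lemma T_sub_hibi (S : set F) : subalgebra S -> hibi_gens K H `<=` S ->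
  forall nu, Tset H 0 nu -> S (Tmon K nu).
Proof.
move=> [Scst _ SM] Sgens nu.
have [n] : exists n : nat, forall x, nu x <= n%:Z.
  exists (\max_x `|nu x|%N) => x.
  have : (`|nu x|%N <= \max_y `|nu y|%N)%N by exact: leq_bigmax.
  by move: (\max_x _)%N (nu x) => t u; lia.
elim: n nu => [|n IHn] nu nu_le nuT.
  have -> : nu = 0.
    apply/ffunP => x; rewrite ffunE; apply/eqP.
    by rewrite eq_le nu_le (Tset0_ge0 _ nuT).
  by rewrite Tmon0 -(cst1 K H).
pose I := [set a : jirr H | 0 < nu (Some a)]%SET.
have iE x : indic I x = (0 < nu x)%R%:Z.
  by rewrite ffunE; case: x => [a|]; rewrite ?inE // nuT.1.
have Idown : down_closed I.
  move=> a b; rewrite le_eqVlt !inE => /predU1P[/val_inj->//|ab].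
  by move=> /lt_le_trans; apply; exact: Tset0_antitone.
rewrite -(TmonK K nu (indic I)); apply: SM; last first.
  have [I0|I0] := eqVneq I finset.set0.
    by rewrite Tmon_indic I0 big_set0 -(cst1 K H).
  by apply: Sgens; exists I; rewrite Tmon_indic.
apply: IHn => [x|].
  rewrite expoD expoN iE; have := nu_le x; have := Tset0_ge0 x nuT.
  by move: (nu x) => t; lia.
apply: Tset0P => [|x y xy]; rewrite !expoD !expoN !iE ?nuT.1 //.
have := Tset0_antitone nuT xy; have := Tset0_ge0 y nuT.
by move: (nu x) (nu y) => t u; lia.
Qed.

Lemma hibiE : hibi K H = T 0.
Proof.
apply/seteqP; split=> [|f fT S [Salg Sgens]].
  have TM f g : T 0 f -> T 0 g -> T 0 (f * g).
    by apply: TspanM => nu mu; exact: TsetD.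
  have Tcst (a : K) : T 0 (cst H a).
    by rewrite -[cst H a]mulr1 -(Tmon0 K H); apply: Tspan_mon; apply: Tset0P;
      rewrite ?ffunE // => x y _; rewrite !ffunE.
  apply: smallest_sub; first split=> // f g fT gT.
    have -> : - g = cst H (-1) * g by rewrite raddfN /= cst1 mulN1r.
    by apply: TspanD => //; exact: TM.
  move=> _ [I [_ Idown ->]]; rewrite -Tmon_indic.
  exact: Tspan_Tmon (Tset_indic Idown).
have [Scst SB SM] := Salg.
have S0 : S 0 by have := Scst 0; rewrite raddf0.
move: f fT; apply: Tspan_ind => // [f g Sf Sg|a nu nuT].
  by rewrite -[g]opprK -[- g]sub0r; exact: SB _ _ Sf (SB _ _ S0 Sg).
by apply: SM => //; exact: T_sub_hibi.
Qed.

(** A common denominator for the span of T^(k): a monomial with exponent in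
    T^(|k|). *)
Lemma T_denominator k :
  exists2 u, T 0 u /\ u != 0 & forall f, T k f -> T 0 (u * f).
Proof.
have [la laT laP] := Tset_denominator H k; exists (Tmon K la).
  by rewrite Tmon_neq0; split=> //; exact: Tspan_Tmon.
move=> f; apply: TspanM (Tspan_Tmon _ (erefl la)) => nu mu <-; exact: laP.
Qed.

Lemma T_frac k : T k `<=` Defs.frac (T 0).
Proof.
move=> f fT; have [u [uT u0] uP] := T_denominator k.
by exists (u * f), u; split=> //; [exact: uP|rewrite mulrC mulKf].
Qed.

(** A quotient q is a Laurent polynomial, because q T^nu0 is one for some nu0;
    multiplying it by monomials that are tight at each covering in turn bounds
    its exponents. *)
Lemma colon_T k : colon (T 0) (T k) = T (- k).
Proof.
apply/seteqP; split=> [q [_ qP]|q qT]; last first.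
  split; first exact: T_frac qT.
  by move=> f; apply: TspanM qT => nu mu nuT /(TsetD nuT); rewrite addNr.
have [nu0 nu0T] := Tset_nonempty H k.
have /TspanP[c cP cT] := qP _ (Tspan_Tmon K nu0T).
have qc : expands q (fun nu => c (nu + nu0)).
  have := expands_shift (- nu0) cP; rewrite -mulrA -TmonD subrr Tmon0 mulr1.
  by rewrite (_ : (fun _ => _) = (fun nu => c (nu + nu0))) //;
    apply/funext => nu; rewrite opprK.
have qN nu : c (nu + nu0) != 0 -> nu None = 0.
  by move=> /cT[+ _]; rewrite expoD nu0T.1 addr0.
apply/TspanP; exists (fun nu => c (nu + nu0)) => // nu c0.
split=> [|x y xy]; first exact: qN.
have [la laT tight] := Tset_tight k xy.
have /TspanP[e eP eT] := qP _ (Tspan_Tmon K laT).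
have ec : e (nu + la) = c (nu + nu0).
  rewrite (expands_inj eP (expands_shift la qc)) ?addrK // => mu.
    by case/eT.
  by move=> /qN; rewrite expoD expoN laT.1 subr0.
have [] := eT (nu + la); rewrite ?ec // => _ /(_ x y xy).
rewrite !expoD -tight.
by move: (nu x) (nu y) (la x) (la y) => ? ? ? ?; lia.
Qed.

Lemma idmul_T k (n : nat) : idmul (T k) (T (k * n%:Z)) = T (k * n.+1%:Z).
Proof.
apply: idmul_Tspan => [nu mu nuT /(TsetD nuT)|la /Tset_split[nu [mu []]]].
  by rewrite (_ : k + _ = k * n.+1%:Z) //; lia.
by exists nu, mu.
Qed.

Lemma idexp_T k (n : nat) : idexp (T 0) (T k) n = T (k * n%:Z).
Proof. by elim: n => [|n IHn]; rewrite ?mulr0 // -idmul_T -IHn. Qed.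

Lemma divpow_T k (n : nat) : iter n (divmul (T 0) (T k)) (T 0) = T (k * n%:Z).
Proof.
elim: n => [|n IHn]; first by rewrite mulr0.
by rewrite iterS IHn /divmul idmul_T !colon_T opprK.
Qed.

Lemma T_Div k : Div (T 0) (T k).
Proof.
split; last by rewrite !colon_T opprK.
split; [exact: T_frac| | |exact: T_denominator].
- move=> r a b rT aT; apply: TspanD; apply: TspanM rT aT => nu mu nuT.
  by move/(TsetD nuT); rewrite add0r.
- have [nu nuT] := Tset_nonempty H k.
  by exists (Tmon K nu); [exact: Tspan_Tmon|exact: Tmon_neq0].
Qed.

End Hibi.

Theorem theorem2p9 (K : fieldType) (d : Order.disp_t)
    (H : finTBDistrLatticeType d) (n : nat) (hn : (0 < n)%N) :
  [/\ Div (hibi K H) (omega K H),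
      idexp (hibi K H) (omega K H) n = divexp (hibi K H) (omega K H) n%:Z,
      is_Tdirect_sum (divexp (hibi K H) (omega K H) n%:Z) (Tset H n%:Z),
      idexp (hibi K H) (divexp (hibi K H) (omega K H) (-1)) n
        = divexp (hibi K H) (omega K H) (- n%:Z)
    & is_Tdirect_sum (divexp (hibi K H) (omega K H) (- n%:Z))
        (Tset H (- n%:Z))].
Proof.
have TN k nu : Tset H k nu -> nu None = 0 by case.
have pos m : divexp (hibi K H) (omega K H) m%:Z = Tspan K H (Tset H m%:Z).
  by rewrite hibiE /= divpow_T mul1r.
have neg m : divexp (hibi K H) (omega K H) (- m.+1%:Z)
    = Tspan K H (Tset H (- m.+1%:Z)).
  by rewrite -NegzE /divexp /divinv hibiE colon_T divpow_T mulN1r.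
case: n hn => // n _; rewrite pos !neg hibiE !idexp_T mul1r mulN1r.
by split=> //; [exact: T_Div| |]; apply: Tspan_direct => nu; exact: TN.
Qed.
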